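(* For every fixed $\xi>0$, $$\lim_{z\to 0^+}\mathrm{e}^{-\xi^2/(2z)}\,z^{1/2}\,\Psi_1\left[1,\tfrac12;\tfrac32,\tfrac12;-z,\frac{\xi^2}{2z}\right]=\frac{\pi}{2}\,\mathrm{erf}\left(\frac{\xi}{\sqrt2}\right).$$
   Context: The Humbert function $\Psi_1$ is defined for $a,b\in\mathbb{C}$, $c,c'\in\mathbb{C}\setminus\mathbb{Z}_{\leqslant 0}$, $|x|<1$, $y\in\mathbb{C}$ by $$\Psi_1[a,b;c,c';x,y]=\sum_{m,n=0}^{\infty}\frac{(a)_{m+n}(b)_m}{(c)_m(c')_n}\frac{x^m}{m!}\frac{y^n}{n!},$$ where $(a)_n=a(a+1)\cdots(a+n-1)$, $(a)_0=1$. The error function is $\mathrm{erf}(t)=\frac{2}{\sqrt\pi}\int_0^t \mathrm{e}^{-s^2}\,\mathrm{d}s$. *)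

(* Defs.v *)
From HB Require Import structures.
From mathcomp Require Import all_boot all_order all_algebra.
From mathcomp Require Import all_classical all_reals all_analysis.
From mathcomp.analysis Require showcase.summability.
Set Implicit Arguments.
Unset Strict Implicit.
Unset Printing Implicit Defensive.
Import Order.TTheory GRing.Theory Num.Theory.
Import numFieldNormedType.Exports.
Local Open Scope classical_set_scope.
Local Open Scope ring_scope.

Definition pochhammer (K : numFieldType) (a : K) (n : nat) : K :=
  \prod_(i < n) (a + i%:R).

(* The field K is generic so that one definition covers both complex and real
   arguments; with K = R the sum is the restriction of the complex function to
   real parameters and variables. *)
Definition humbert_Psi1_term (K : numFieldType) (a b c c' x y : K)
    (p : nat * nat) : K :=
  let: (m, n) := p in
  (pochhammer a (m + n) * pochhammer b m) / (pochhammer c m * pochhammer c' n)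
  * (x ^+ m / (m`!)%:R) * (y ^+ n / (n`!)%:R).

(* The double series is the unconditional sum over nat * nat (the limit of the
   finite partial sums along the directed set of finite subsets).  The value is
   meaningful only where the series converges absolutely, e.g. for `|x| < 1 and
   c, c' not non-positive integers. *)
Definition humbert_Psi1 (K : numFieldType) (a b c c' x y : K) : K :=
  summability.sum (R := K^o) (humbert_Psi1_term a b c c' x y).

(* The integral from 0 to t is oriented: it changes sign for t < 0. *)
Definition erf (R : realType) (t : R) : R :=
  2 / Num.sqrt pi *
  (if 0 <= t
   then \int[lebesgue_measure]_(s in `[0, t]) expR (- s ^+ 2)
   else - \int[lebesgue_measure]_(s in `[t, 0]) expR (- s ^+ 2)).

(* Main.v *)
Require Import Defs.
From HB Require Import structures.
From mathcomp Require Import all_boot all_order all_algebra.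
From mathcomp Require Import finmap ring lra.
From mathcomp Require Import all_classical all_reals all_analysis.
From mathcomp Require Import measurable_realfun.
From mathcomp.analysis Require showcase.summability.
Set Implicit Arguments.
Unset Strict Implicit.
Unset Printing Implicit Defensive.
Import Order.TTheory GRing.Theory Num.Theory.
Import numFieldNormedType.Exports.
Local Open Scope classical_set_scope.
Local Open Scope ring_scope.

(** Write [F] for the confluent hypergeometric function 1F1(1; 1/2; .), called
    [half_kummer] below. For the parameters of the theorem the term of the double
    series is [C(m+n, m) x^m / (2m+1)] times the coefficient [y^n / (1/2)_n] of
    [F y]. Since [1 / (2m+1)] is the integral of [t^(2m)] over [0, 1], the sum over
    [m] is the integral of [(1 - x t^2)^-(n+1)], and the sum over [n] then gives
    ([humbert_Psi1_Rintegral]), for [|x| < 1], that the function is the integral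
    over [0 <= t <= 1] of [q * F (y q)], where [q = 1 / (1 - x t^2)].

    The growth of [F] is known exactly: [F (s^2) = 1 + 2 s exp(s^2) G(s)], where
    [G(s)] is the integral of [exp(- u^2)] from [0] to [s] ([half_kummer_sqr]), and
    [G(s)] increases to [sqrt pi / 2].

    Put [a = xi / sqrt 2], [x = - z] and [y = a^2 / z]. In the scaled integrand the
    two exponentials combine into [exp(- a^2 t^2 q)] and the square roots into
    [a sqrt q] ([scaled_integrandE]). It is therefore bounded for [0 < z <= 1] and
    tends to [sqrt pi * a * exp(- a^2 t^2)] as [z] tends to [0], because [q] tends
    to [1] and the argument of [G] to infinity. By bounded convergence the limit is
    [sqrt pi * G(a)], that is [pi / 2 * erf a]. *)

(** * Unconditional double sums as iterated series *)

Lemma ler_sum_fset (R : realType) (I : choiceType) (f : I -> R) (A B : {fset I}) :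
  (forall i, 0 <= f i) -> (A `<=` B)%fset ->
  \sum_(i <- A) f i <= \sum_(i <- B) f i.
Proof.
move=> f0 AB; rewrite [leRHS](big_fsetID _ (mem A))/= -[leLHS]addr0.
rewrite lerD ?sumr_ge0//.
suff -> : [fset x in B | x \in A]%fset = A by [].
by apply/fsetP => i; rewrite !inE andb_idl//; move/fsubsetP : AB; apply.
Qed.

(** Rectangles are cofinal among the finite sets of index pairs, so the net of
    finite partial sums can be compared with iterated partial sums. *)
Definition rectangle (M N : nat) : {fset nat * nat} :=
  [fset p in [seq (m, n) | m <- iota 0 M, n <- iota 0 N]]%fset.

Lemma mem_rectangle M N p : (p \in rectangle M N) = (p.1 < M)%N && (p.2 < N)%N.
Proof.
rewrite inE /=; case: p => m n /=; apply/allpairsP/andP => [[[i j] /= []]|[mM nN]].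
  by rewrite !mem_iota /= => ? ? [-> ->].
by exists (m, n); rewrite !mem_iota.
Qed.

Lemma sum_rectangle (R : realType) (f : nat * nat -> R) M N :
  \sum_(p <- rectangle M N) f p =
  \sum_(0 <= n < N) \sum_(0 <= m < M) f (m, n).
Proof.
rewrite exchange_big/= /index_iota !subn0 -(big_allpairs (F := f)).
apply: perm_big; apply: uniq_perm; first exact: fset_uniq.
  by rewrite allpairs_uniq ?iota_uniq// => -[? ?] [].
by move=> p; rewrite [in LHS]inE.
Qed.

Lemma fsubset_rectangle (J : {fset nat * nat}) :
  exists M N, (J `<=` rectangle M N)%fset.
Proof.
exists (\max_(p <- J) p.1).+1, (\max_(p <- J) p.2).+1.
apply/fsubsetP => p pJ; rewrite mem_rectangle !ltnS.
by apply/andP; split; rewrite (big_fsetD1 p)//= leq_maxl.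
Qed.

Lemma series_le_lim (R : realType) (u : nat -> R) l n :
  (forall k, 0 <= u k) -> series u @ \oo --> l -> series u n <= l.
Proof.
move=> u0 ul; rewrite -(cvg_lim (@Rhausdorff R) ul).
apply: nondecreasing_cvgn_le; last exact: cvgP ul.
by apply: nondecreasing_series => k _ _; exact: u0.
Qed.

#[local] Existing Instance summability.totally_filter.

(** For nonnegative terms the net of finite sums increases: every finite sum lies
    below [S] because its index set sits in a rectangle, and rectangles with
    enough rows, then enough entries in each of these rows, come arbitrarily
    close to [S]. *)
Lemma ge0_partial_sum_iterated (R : realType) (f : nat * nat -> R)
    (A : nat -> R) (S : R) :
  (forall p, 0 <= f p) ->
  (forall n, series (fun m => f (m, n)) @ \oo --> A n) ->
  series A @ \oo --> S ->
  summability.partial_sum (R := R^o) f @ summability.totally --> (S : R^o).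
Proof.
move=> f0 fA AS.
have A0 n : 0 <= A n.
  by apply: le_trans (series_le_lim 0%N _ (fA n)) => //; rewrite /series/= big_geq.
have sE (J : {fset nat * nat}) :
    summability.partial_sum (R := R^o) f J = \sum_(p <- J) f p.
  by rewrite /summability.partial_sum big_seq_fsetE.
have ub J : summability.partial_sum (R := R^o) f J <= S.
  have [M [N JMN]] := fsubset_rectangle J.
  rewrite sE (le_trans (ler_sum_fset f0 JMN))// sum_rectangle.
  apply: le_trans (series_le_lim N A0 AS); apply: ler_sum => n _.
  exact: series_le_lim (fA n).
apply/cvgrPdist_le => e e0.
have e20 : 0 < e / 2 by rewrite divr_gt0.
have [N _ /(_ _ (leqnn N)) NS] := (cvgrPdist_le _ _).1 AS _ e20.
have : \sum_(0 <= n < N) series (fun m => f (m, n)) M @[M --> \oo] --> series A N.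
  apply: cvg_big; [exact: add_continuous|by move=> n _; exact: fA].
move=> /cvgrPdist_le /(_ _ e20)[M _ /(_ _ (leqnn M)) MA].
(* [N] rows lose at most e/2 of the total, truncating them at [M] another e/2 *)
exists (rectangle M N) => // J /= MNJ.
rewrite ger0_norm ?subr_ge0//.
have := ler_sum_fset f0 MNJ; rewrite -(sE J) sum_rectangle.
move: NS MA => /(le_trans (ler_norm _)) + /(le_trans (ler_norm _)).
rewrite /series /=.
lra.
Qed.

(** Fubini for absolutely convergent double series. The signed case is reduced
    to the nonnegative one by writing [f] as the difference of the nonnegative
    families [f + |f|] and [|f|], whose rows have the sums [B + A] and [A]. *)
Lemma sum_iterated (R : realType) (f : nat * nat -> R) (A B : nat -> R) (S T : R) :
  (forall n, series (fun m => `|f (m, n)|) @ \oo --> A n) ->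
  series A @ \oo --> T ->
  (forall n, series (fun m => f (m, n)) @ \oo --> B n) ->
  series B @ \oo --> S ->
  summability.sum (R := R^o) f = S.
Proof.
move=> fA AT fB BS; apply: cvg_lim => //.
have pT := ge0_partial_sum_iterated (fun p => normr_ge0 (f p)) fA AT.
have f1 p : 0 <= f p + `|f p| by rewrite -lerBlDr sub0r lerNl -normrN ler_norm.
have pST : summability.partial_sum (R := R^o) (fun p => f p + `|f p|)
    @ summability.totally --> (S + T : R^o).
  apply: (@ge0_partial_sum_iterated _ _ (fun n => B n + A n)) => // [n|].
    by rewrite (_ : series _ =
      series (fun m => f (m, n)) \+ series (fun m => `|f (m, n)|));
      [apply: cvgD|apply/funext => k; rewrite /series/= big_split].
  by rewrite (_ : series _ = series B \+ series A);
    [apply: cvgD|apply/funext => k; rewrite /series/= big_split].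
rewrite -[S](addrK T) (_ : summability.partial_sum f =
  summability.partial_sum (R := R^o) (fun p => f p + `|f p|) \-
  summability.partial_sum (R := R^o) (fun p => `|f p|)).
  by apply: cvgB.
by apply/funext => J; rewrite /summability.partial_sum/= big_split/= addrK.
Qed.

(** * Bounded convergence and integrals over the unit interval *)

Lemma bounded_integrable d (T : measurableType d) (R : realType)
    (mu : {measure set T -> \bar R}) (D : set T) (f : T -> R) (C : R) :
  measurable D -> (mu D < +oo)%E -> measurable_fun D f ->
  (forall t, D t -> `|f t| <= C) -> mu.-integrable D (EFin \o f).
Proof.
move=> mD Dfin mf fC; apply: measurable_bounded_integrable => //.
exists C; split; first exact: num_real.
by move=> M CM t Dt /=; rewrite (le_trans (fC _ Dt))// ltW.
Qed.

(** The bounded convergence theorem, by which all interchanges of a limit with an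
    integral are made below. The limit is measurable as a pointwise limit. *)
Lemma bounded_cvg_Rintegral d (T : measurableType d) (R : realType)
    (mu : {measure set T -> \bar R}) (D : set T)
    (h : nat -> T -> R) (g : T -> R) (C : R) :
  measurable D -> (mu D < +oo)%E ->
  (forall k, measurable_fun D (h k)) ->
  (forall k t, D t -> `|h k t| <= C) ->
  (forall t, D t -> h k t @[k --> \oo] --> g t) ->
  \int[mu]_(t in D) h k t @[k --> \oo] --> \int[mu]_(t in D) g t.
Proof.
move=> mD Dfin mh hC hg.
have mg : measurable_fun D g by exact: measurable_fun_cvg hg.
have intC k : mu.-integrable D (EFin \o h k).
  by apply: bounded_integrable (hC k).
have [|||||intg _] := @dominated_convergence _ _ _ mu D mD
    (fun k t => (h k t)%:E) (EFin \o g) (cst C%:E).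
- by move=> n; exact/measurable_EFinP.
- exact/measurable_EFinP.
- by apply/aeW => t Dt; apply/cvg_EFin; [exact: nearW|exact: hg].
- by apply: (@bounded_integrable _ _ _ _ _ (cst C) `|C|) => //.
- by apply/aeW => t n Dt; rewrite lee_fin hC.
by move=> hgE; apply: fine_cvg; rewrite fineK ?integrable_fin_num.
Qed.

Lemma cvg_series_Rintegral d (T : measurableType d) (R : realType)
    (mu : {measure set T -> \bar R}) (D : set T)
    (u : nat -> T -> R) (g : T -> R) (C : R) :
  measurable D -> (mu D < +oo)%E ->
  (forall k, measurable_fun D (u k)) ->
  (forall n t, D t -> `|series (u^~ t) n| <= C) ->
  (forall t, D t -> series (u^~ t) @ \oo --> g t) ->
  series (fun k => \int[mu]_(t in D) u k t) @ \oo --> \int[mu]_(t in D) g t.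
Proof.
move=> mD Dfin mu_ uC ug.
have ms n : measurable_fun D (fun t => series (u^~ t) n).
  by apply: measurable_sum.
have -> : series (fun k => \int[mu]_(t in D) u k t) =
    fun n => \int[mu]_(t in D) series (u^~ t) n.
  apply/funext; elim => [|n IH].
    rewrite /series/= big_geq//; under eq_Rintegral do rewrite big_geq//.
    by rewrite Rintegral_cst// mul0r.
  rewrite seriesSr IH -RintegralD//; last 2 first.
  - by apply: bounded_integrable (uC n).
  - apply: (@bounded_integrable _ _ _ _ _ _ (C + C)) => // t Dt.
    rewrite (_ : u n t = series (u^~ t) n.+1 - series (u^~ t) n); last first.
      by rewrite seriesSr addrAC subrr add0r.
    by rewrite (le_trans (ler_normB _ _))// lerD ?uC.
  by apply: eq_Rintegral => t _; rewrite seriesSr.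
by apply: bounded_cvg_Rintegral ug => //; exact: uC.
Qed.

Lemma lebesgue_measure01_lty (R : realType) :
  (@lebesgue_measure R `[0%R, 1%R] < +oo)%E.
Proof. by rewrite lebesgue_measure_itv/= lte01 oppr0 adde0 ltry. Qed.

Lemma Rintegral_deriv_poly (R : realType) (p : {poly R}) :
  \int[lebesgue_measure]_(t in `[0, 1]) p^`().[t] = p.[1] - p.[0].
Proof.
rewrite /Rintegral (@continuous_FTC2 _ _ (horner p)) => //.
- by apply: continuous_subspaceT => x; exact: continuous_horner.
- split; last 2 first.
  + by apply: cvg_at_right_filter; exact: continuous_horner.
  + by apply: cvg_at_left_filter; exact: continuous_horner.
  + by move=> x _; exact: derivable_horner.
- by move=> x _; rewrite derive1E derive_val.
Qed.

Lemma Rintegral01_exprn (R : realType) (n : nat) :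
  \int[lebesgue_measure]_(t in `[0, 1]) (t ^+ n) = n.+1%:R^-1 :> R.
Proof.
have := Rintegral_deriv_poly (n.+1%:R^-1 *: 'X^(n.+1) : {poly R}).
rewrite !hornerE expr1n expr0n/= mulr1 mulr0 subr0 => <-.
apply: eq_Rintegral => t _; rewrite derivZ derivXn !hornerE/=.
by rewrite hornerMn hornerXn -(mulr_natr (t ^+ n)) mulrCA mulVf ?mulr1 ?pnatr_eq0.
Qed.

(** * The inner series: negative binomial sums *)

(** Pascal's rule, summed: the finite form of multiplication by [1 - u]. *)
Lemma series_negative_binomialS (R : realType) (u : R) n M :
  series (fun m => 'C(m + n.+1, m)%:R * u ^+ m) M.+1 =
  series (fun m => 'C(m + n, m)%:R * u ^+ m) M.+1 +
  u * series (fun m => 'C(m + n.+1, m)%:R * u ^+ m) M.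
Proof.
rewrite /series/= ![in LHS]big_nat_recl// [in RHS]big_nat_recl// -addrA.
rewrite !bin0; congr (_ + _); rewrite mulr_sumr -big_split; apply: eq_bigr => m _ /=.
rewrite addSn binS natrD exprS -addSnnS; ring.
Qed.

Lemma norm_series_negative_binomial (R : realType) (u : R) n M :
  `|series (fun m => 'C(m + n, m)%:R * u ^+ m) M| <=
  series (fun m => 'C(m + n, m)%:R * `|u| ^+ m) M.
Proof.
rewrite /series/= (le_trans (ler_norm_sum _ _ _))//.
by apply: ler_sum => m _; rewrite normrM normr_nat normrX.
Qed.

(** By induction on [n]. Pascal's rule shows that a limit [L] at rank [n + 1]
    satisfies [L = T + u * L], where [T] is the limit at rank [n]. A limit exists
    because, for [0 <= v < 1], the same rule bounds the increasing partial sums by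
    [T / (1 - v)]; a general [u] follows by absolute convergence. *)
Lemma cvg_negative_binomial (R : realType) (u : R) n : `|u| < 1 ->
  series (fun m => 'C(m + n, m)%:R * u ^+ m) @ \oo --> (1 - u)^-1 ^+ n.+1.
Proof.
elim: n u => [|n IH] u u1.
  rewrite expr1 (_ : series _ = series (geometric 1 u)).
    by have := @cvg_geometric_series _ 1 _ u1; rewrite mul1r.
  by congr series; apply/funext => m; rewrite addn0 binn.
have bounded_case (v : R) : 0 <= v -> v < 1 ->
    cvgn (series (fun m => 'C(m + n.+1, m)%:R * v ^+ m)).
  move=> v0 v1; have term0 (k m : nat) : 0 <= 'C(m + k, m)%:R * v ^+ m.
    by rewrite mulr_ge0// exprn_ge0.
  apply: nondecreasing_is_cvgn; first by apply: nondecreasing_series => m _ _; exact: term0.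
  exists ((1 - v)^-1 ^+ n.+1 / (1 - v)) => _ [M _ <-].
  rewrite ler_pdivlMr ?subr_gt0// mulrBr mulr1 lerBlDr [X in _ + X]mulrC.
  apply: le_trans (_ : series (fun m => 'C(m + n.+1, m)%:R * v ^+ m) M.+1 <= _).
    by rewrite seriesSr lerDl; exact: term0.
  rewrite series_negative_binomialS lerD2r; apply: series_le_lim (term0 n) _.
  by apply: IH; rewrite ger0_norm.
have cu : cvgn (series (fun m => 'C(m + n.+1, m)%:R * u ^+ m)).
  apply: normed_cvg; rewrite (_ : [normed _] =
    series (fun m => 'C(m + n.+1, m)%:R * `|u| ^+ m)); first exact: bounded_case.
  by apply/funext => M; apply: eq_bigr => m _ /=; rewrite normrM normr_nat normrX.
suff : limn (series (fun m => 'C(m + n.+1, m)%:R * u ^+ m)) = (1 - u)^-1 ^+ n.+2.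
  by move=> <-.
have uneq : 1 - u != 0 by rewrite subr_eq0 eq_sym lt_eqF// (le_lt_trans (ler_norm _)).
have : limn (series (fun m => 'C(m + n.+1, m)%:R * u ^+ m)) =
  (1 - u)^-1 ^+ n.+1 + u * limn (series (fun m => 'C(m + n.+1, m)%:R * u ^+ m)).
  apply: cvg_lim => //; rewrite -cvg_shiftS.
  under eq_fun do rewrite series_negative_binomialS.
  apply: cvgD; first by rewrite (cvg_shiftS (series _)); exact: IH.
  by apply: cvgMl_tmp; exact: cu.
move: (limn _) => L LE; apply: (mulfI uneq); rewrite exprS mulrA mulfV// mul1r.
by rewrite mulrBl mul1r {1}LE addrK.
Qed.

Section unit_interval.
Context {R : realType}.
Implicit Types (x t : R) (n : nat).

Let norm_lt1 x t : `|x| < 1 -> `[0, 1]%classic t -> `|x * t ^+ 2| <= `|x|.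
Proof.
move=> x1; rewrite /= in_itv/= => /andP[t0 t1].
by rewrite normrM ler_piMr// ger0_norm ?exprn_ge0// exprn_ile1.
Qed.

Lemma negative_power_le x t n : `|x| < 1 -> `[0, 1]%classic t ->
  0 <= (1 - x * t ^+ 2)^-1 ^+ n <= (1 - `|x|)^-1 ^+ n.
Proof.
move=> x1 t01; have xt := norm_lt1 x1 t01.
have p : 1 - `|x| <= 1 - x * t ^+ 2 by rewrite lerD2l lerN2 (le_trans (ler_norm _)).
have q : 0 < 1 - `|x| by rewrite subr_gt0.
have r := lt_le_trans q p.
apply/andP; split; first by rewrite exprn_ge0// invr_ge0 ltW.
by apply: lerXn2r; rewrite ?nnegrE ?invr_ge0 ?(ltW r) ?(ltW q)// lef_pV2.
Qed.

Lemma cvg_negative_binomial_sqr x t n : `|x| < 1 -> `[0, 1]%classic t ->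
  series (fun m => 'C(m + n, m)%:R * x ^+ m * t ^+ (2 * m)) @ \oo -->
  (1 - x * t ^+ 2)^-1 ^+ n.+1.
Proof.
move=> x1 t01; under [X in series X]eq_fun do rewrite exprM -mulrA -exprMn.
by apply: cvg_negative_binomial; exact: le_lt_trans (norm_lt1 x1 t01) _.
Qed.

(** Measurability is obtained from the geometric series, which makes it
    unnecessary to discuss the zeros of [1 - x * t ^ 2] outside the interval. *)
Lemma measurable_negative_power x n : `|x| < 1 ->
  measurable_fun (`[0, 1] : set R) (fun t => (1 - x * t ^+ 2)^-1 ^+ n).
Proof.
move=> x1; apply: measurable_funX.
apply: (measurable_fun_cvg (h := fun k t =>
  series (fun m => 'C(m + 0, m)%:R * x ^+ m * t ^+ (2 * m)) k)).
  by move=> k; apply: measurable_sum => m; exact: measurable_funM.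
by move=> t t01; exact: (@cvg_negative_binomial_sqr _ _ 0).
Qed.

(** The factor [1 / (2 m + 1)] is the integral of [t ^ (2 m)] over the unit
    interval, so the negative binomial series in [x * t ^ 2] is integrated term
    by term. *)
Lemma cvg_series_negative_binomial_Rintegral x n : `|x| < 1 ->
  series (fun m => 'C(m + n, m)%:R * x ^+ m / (2 * m).+1%:R) @ \oo -->
  \int[lebesgue_measure]_(t in `[0, 1]) ((1 - x * t ^+ 2)^-1 ^+ n.+1).
Proof.
move=> x1.
have fin01 := lebesgue_measure01_lty R.
rewrite (_ : (fun m => _) = fun m => \int[lebesgue_measure]_(t in `[0, 1])
    ('C(m + n, m)%:R * x ^+ m * t ^+ (2 * m))); last first.
  apply/funext => m; rewrite RintegralZl ?Rintegral01_exprn//.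
  apply: (@bounded_integrable _ _ _ _ _ _ 1) => //.
  move=> t /=; rewrite in_itv/= => /andP[t0 t1].
  by rewrite ger0_norm ?exprn_ge0// exprn_ile1.
apply: (@cvg_series_Rintegral _ _ _ _ _ _ _ ((1 - `|x|)^-1 ^+ n.+1)) => //.
- by move=> m; exact: measurable_funM.
- move=> M t t01; under [X in series X]eq_fun do rewrite exprM -mulrA -exprMn.
  apply: (le_trans (norm_series_negative_binomial _ _ _)).
  apply: (@le_trans _ _ (series (fun m => 'C(m + n, m)%:R * `|x| ^+ m) M)).
    apply: ler_sum => m _; rewrite ler_wpM2l// lerXn2r ?nnegrE//.
    exact: norm_lt1.
  apply: series_le_lim => [m|]; first by rewrite mulr_ge0// exprn_ge0.
  by apply: cvg_negative_binomial; rewrite normr_id.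
- by move=> t t01; exact: cvg_negative_binomial_sqr.
Qed.

End unit_interval.

(** * The terms of the double series *)

Section pochhammer_half.
Context {R : realType}.
Implicit Types (m n : nat).

Lemma pochhammerS (a : R) n : pochhammer a n.+1 = pochhammer a n * (a + n%:R).
Proof. by rewrite /pochhammer big_ord_recr. Qed.

Lemma pochhammer1 n : pochhammer 1 n = n`!%:R :> R.
Proof.
elim: n => [|n IH]; first by rewrite /pochhammer big_ord0.
by rewrite pochhammerS IH factS natrM -(natr1 n); ring.
Qed.

Lemma pochhammer_gt0 (a : R) n : 0 < a -> 0 < pochhammer a n.
Proof. by move=> a0; apply: prodr_gt0 => i _; rewrite ltr_wpDr. Qed.

Lemma pochhammer_three_halves m :
  pochhammer (3 / 2) m = pochhammer (1 / 2) m * (2 * m).+1%:R :> R.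
Proof.
elim: m => [|m IH]; first by rewrite /pochhammer !big_ord0 mulr1.
rewrite !pochhammerS IH -(natr1 (2 * m.+1)) -(natr1 (2 * m)) !natrM -(natr1 m).
by field.
Qed.

(** For these parameters the term factors into a negative binomial coefficient in
    [x], weighted by [1 / (2 m + 1)], and a coefficient of [1F1(1; 1/2; y)]. *)
Lemma humbert_Psi1_termE (x y : R) m n :
  humbert_Psi1_term 1 (1 / 2) (3 / 2) (1 / 2) x y (m, n) =
  'C(m + n, m)%:R * x ^+ m / (2 * m).+1%:R * (y ^+ n / pochhammer (1 / 2) n).
Proof.
rewrite /humbert_Psi1_term pochhammer1 pochhammer_three_halves.
have <- := @bin_fact (m + n) m (leq_addr _ _).
rewrite addKn !natrM; field.
rewrite !gt_eqF ?pochhammer_gt0//; lra.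
Qed.

Lemma integrable_onem_sqr k : lebesgue_measure.-integrable (`[0, 1] : set R)
    (EFin \o (fun v : R => (1 - v ^+ 2) ^+ k)).
Proof.
apply: (@bounded_integrable _ _ _ _ _ _ 1) => //.
- exact: lebesgue_measure01_lty.
- by apply: measurable_funX; apply: measurable_funB.
- move=> t /=; rewrite in_itv/= => /andP[t0 t1].
  have : 0 <= 1 - t ^+ 2 <= 1.
    by rewrite subr_ge0 exprn_ile1//= lerBlDr lerDl exprn_ge0.
  by move=> /andP[? ?]; rewrite ger0_norm ?exprn_ge0// exprn_ile1.
Qed.

(** A Wallis integral, by the recursion
    [(2 n + 3) I_(n+1) = 2 (n + 1) I_n], which expresses that the derivative of
    [v (1 - v ^ 2) ^ (n + 1)] has integral zero over the unit interval. *)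
Lemma Rintegral01_onem_sqr n :
  pochhammer (1 / 2) n.+1 *
    (\int[lebesgue_measure]_(v in `[0, 1]) ((1 - v ^+ 2) ^+ n)) = n`!%:R / 2 :> R.
Proof.
elim: n => [|n IH].
  under eq_Rintegral do rewrite expr0.
  rewrite Rintegral_cst//= lebesgue_measure_itv/= lte01 oppr0 addr0.
  by rewrite /pochhammer big_ord1 fact0 -[fine _]/(1 : R) addr0 mulr1 mulr1.
have ibl := integrable_onem_sqr.
have E : (2 * n%:R + 3) *
    (\int[lebesgue_measure]_(v in `[0, 1]) ((1 - v ^+ 2) ^+ n.+1)) =
  2 * n.+1%:R * \int[lebesgue_measure]_(v in `[0, 1]) ((1 - v ^+ 2) ^+ n) :> R.
  apply: subr0_eq; rewrite -!RintegralZl// -RintegralB//; last 2 first.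
  - exact: (@integrableZl _ _ _ _ _ _ _ _ (ibl n.+1)).
  - exact: (@integrableZl _ _ _ _ _ _ _ _ (ibl n)).
  transitivity (\int[lebesgue_measure]_(t in `[0, 1])
      ('X * (1 - 'X ^+ 2) ^+ n.+1 : {poly R})^`().[t]); last first.
    by rewrite Rintegral_deriv_poly !hornerE expr1n subrr expr0n/= subr0.
  apply/eq_Rintegral => t _.
  rewrite derivM derivX deriv_exp derivB derivC derivXn; rewrite !hornerE /=.
  rewrite hornerMn !hornerE -(mulr_natr (_ * _) n.+1) -(natr1 n) exprS; ring.
rewrite pochhammerS (_ : _ * _ = pochhammer (1 / 2) n.+1 / 2 * ((2 * n%:R + 3) *
  \int[lebesgue_measure]_(v in `[0, 1]) ((1 - v ^+ 2) ^+ n.+1))); last first.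
  by rewrite -natr1; field.
rewrite E (_ : _ * _ = n.+1%:R * (pochhammer (1 / 2) n.+1 *
  \int[lebesgue_measure]_(v in `[0, 1]) ((1 - v ^+ 2) ^+ n))); last by field.
by rewrite IH factS natrM mulrA.
Qed.
End pochhammer_half.

(** * The confluent hypergeometric function 1F1(1; 1/2; w) *)

(** An integral form of 1F1(1; 1/2; w), chosen because it turns into a Gaussian
    integral after the substitution [s = v * sqrt w]; the power series is
    recovered in [cvg_series_half_kummer]. *)
Definition half_kummer {R : realType} (w : R) : R :=
  1 + 2 * w * \int[lebesgue_measure]_(v in `[0, 1]) expR (w * (1 - v ^+ 2)).

Section half_kummer.
Context {R : realType}.
Implicit Types (w x y : R).

Lemma series_exp_coeff_le w n : `|series (exp_coeff w) n| <= expR `|w|.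
Proof.
apply: (@le_trans _ _ (series (exp_coeff `|w|) n)).
  rewrite (le_trans (ler_norm_sum _ _ _))//; apply: ler_sum => k _.
  by rewrite /exp_coeff/= normrM normfV normr_nat normrX.
apply: series_le_lim => [k|]; first exact: exp_coeff_ge0.
exact: is_cvg_series_exp_coeff.
Qed.

(** The exponential under the integral sign is expanded and integrated term by
    term; the Wallis integral turns the coefficient of order [n] into the one of
    order [n + 1] of 1F1(1; 1/2; w). *)
Lemma cvg_series_half_kummer w :
  series (fun n => w ^+ n / pochhammer (1 / 2) n) @ \oo --> half_kummer w.
Proof.
have mexp k : measurable_fun (`[0, 1] : set R) (fun v => exp_coeff (w * (1 - v ^+ 2)) k).
  apply: measurable_funM => //; apply: measurable_funX.
  by apply: measurable_funM => //; apply: measurable_funB.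
have pow_le v : `[0, 1]%classic v -> `|w * (1 - v ^+ 2)| <= `|w|.
  rewrite /= in_itv/= => /andP[v0 v1]; rewrite normrM ler_piMr// ger0_norm.
    by rewrite lerBlDr lerDl exprn_ge0.
  by rewrite subr_ge0 exprn_ile1.
have termE n : w ^+ n.+1 / pochhammer (1 / 2) n.+1 = 2 * w *
    \int[lebesgue_measure]_(v in `[0, 1]) exp_coeff (w * (1 - v ^+ 2)) n.
  have p0 : pochhammer (1 / 2 : R) n.+1 != 0 by rewrite gt_eqF ?pochhammer_gt0.
  have n0 : n`!%:R != 0 :> R by rewrite pnatr_eq0 -lt0n fact_gt0.
  under eq_Rintegral do rewrite /exp_coeff/= exprMn mulrAC.
  rewrite RintegralZl//; last exact: integrable_onem_sqr.
  apply: (mulfI p0); rewrite mulrCA mulfV// mulr1.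
  rewrite (_ : pochhammer _ _ * _ = 2 * w * (w ^+ n / n`!%:R) * (pochhammer (1 / 2) n.+1 *
    \int[lebesgue_measure]_(v in `[0, 1]) ((1 - v ^+ 2) ^+ n))); last by ring.
  by rewrite Rintegral01_onem_sqr exprS; field.
rewrite -cvg_shiftS (_ : (fun n => _) = (fun n => 1 + 2 * w *
    series (fun n => \int[lebesgue_measure]_(v in `[0, 1])
      exp_coeff (w * (1 - v ^+ 2)) n) n)); last first.
  apply/funext => n; rewrite /series/= big_nat_recl//; congr (_ + _).
    by rewrite /pochhammer big_ord0 expr0 divr1.
  by rewrite mulr_sumr; apply: eq_bigr => k _; exact: termE.
apply: cvgD; first exact: cvg_cst.
apply: cvgMl_tmp.
apply: (@cvg_series_Rintegral _ _ _ _ _ _ _ (expR `|w|)) => //.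
- exact: lebesgue_measure01_lty.
- move=> n v v01; rewrite (le_trans (series_exp_coeff_le _ _))// ler_expR.
  exact: pow_le.
- by move=> v _; exact: is_cvg_series_exp_coeff.
Qed.

Lemma measurable_half_kummer : measurable_fun setT (@half_kummer R).
Proof.
apply: (@measurable_fun_cvg _ _ _ _
  (fun k w => series (fun n => w ^+ n / pochhammer (1 / 2) n) k)).
  by move=> k; apply: measurable_sum => n; exact: measurable_funM.
by move=> w _; exact: cvg_series_half_kummer.
Qed.

(** The outer series. With [q = 1 / (1 - x t ^ 2)] the integrand of order [n] is
    [q] times the term of order [n] of [half_kummer (y q)], and the partial sums
    are dominated by their values at [|y|] and at the largest possible [q]. *)
Lemma cvg_series_half_kummer_Rintegral x y : `|x| < 1 ->
  series (fun n => y ^+ n / pochhammer (1 / 2) n *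
    \int[lebesgue_measure]_(t in `[0, 1]) ((1 - x * t ^+ 2)^-1 ^+ n.+1)) @ \oo -->
  \int[lebesgue_measure]_(t in `[0, 1])
    ((1 - x * t ^+ 2)^-1 * half_kummer (y * (1 - x * t ^+ 2)^-1)).
Proof.
move=> x1.
pose q t := (1 - x * t ^+ 2)^-1; pose c n : R := (pochhammer (1 / 2) n)^-1.
have c0 n : 0 <= c n by rewrite invr_ge0 ltW// pochhammer_gt0.
have q01 t : `[0, 1]%classic t -> 0 <= q t <= (1 - `|x|)^-1.
  by move=> /(negative_power_le 1 x1); rewrite !expr1.
have mq n : measurable_fun (`[0, 1] : set R) (fun t => q t ^+ n).
  exact: measurable_negative_power.
rewrite (_ : (fun n => _) = fun n => \int[lebesgue_measure]_(t in `[0, 1])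
    (q t * ((y * q t) ^+ n * c n))); last first.
  apply/funext => n; rewrite -RintegralZl//.
    by apply: eq_Rintegral => t _; rewrite -/(q t) exprMn exprS -/(c n); ring.
  apply: (@bounded_integrable _ _ _ _ _ _ ((1 - `|x|)^-1 ^+ n.+1)) => //.
  + exact: lebesgue_measure01_lty.
  + exact: mq.
  + by move=> t /(negative_power_le n.+1 x1)/andP[? ?]; rewrite ger0_norm.
have sE t n : series (fun k => q t * ((y * q t) ^+ k * c k)) n =
    q t * series (fun k => (y * q t) ^+ k * c k) n.
  by rewrite /series/= mulr_sumr.
apply: (@cvg_series_Rintegral _ _ _ _ _ _ _
  ((1 - `|x|)^-1 * half_kummer (`|y| * (1 - `|x|)^-1))) => //.
- exact: lebesgue_measure01_lty.
- move=> n; rewrite (_ : (fun _ => _) = fun t => y ^+ n * c n * q t ^+ n.+1).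
    by apply: measurable_funM => //; exact: mq.
  by apply/funext => t; rewrite exprMn exprS; ring.
- move=> n t t01; have /andP[q0 q1] := q01 _ t01.
  rewrite sE normrM (ger0_norm q0) ler_pM//.
  apply: (@le_trans _ _
    (series (fun k => (`|y| * (1 - `|x|)^-1) ^+ k * c k) n)); last first.
    apply: series_le_lim; last exact: cvg_series_half_kummer.
    move=> k; rewrite mulr_ge0// exprn_ge0// mulr_ge0//; exact: le_trans q1.
  apply: (le_trans (ler_norm_sum _ _ _)); apply: ler_sum => k _.
  rewrite normrM normrX (ger0_norm (c0 k)) ler_wpM2r// lerXn2r ?nnegrE//.
    by rewrite mulr_ge0// (le_trans q0).
  by rewrite normrM (ger0_norm q0) ler_wpM2l.
- move=> t t01; rewrite (_ : series _ = fun n =>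
      q t * series (fun k => (y * q t) ^+ k * c k) n).
    by apply: cvgMl_tmp; exact: cvg_series_half_kummer.
  by apply/funext => n; exact: sE.
Qed.

(** Summation over [m] first. The rows of the absolute values are the rows at
    [|x|], [|y|], so the same two term-by-term integrations give both the
    absolute convergence and the value. *)
Lemma humbert_Psi1_Rintegral x y : `|x| < 1 ->
  humbert_Psi1 1 (1 / 2) (3 / 2) (1 / 2) x y =
  \int[lebesgue_measure]_(t in `[0, 1])
    ((1 - x * t ^+ 2)^-1 * half_kummer (y * (1 - x * t ^+ 2)^-1)).
Proof.
move=> x1.
have row (x' y' : R) n : `|x'| < 1 ->
    series (fun m => 'C(m + n, m)%:R * x' ^+ m / (2 * m).+1%:R *
                     (y' ^+ n / pochhammer (1 / 2) n)) @ \oo -->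
    y' ^+ n / pochhammer (1 / 2) n *
      \int[lebesgue_measure]_(t in `[0, 1]) ((1 - x' * t ^+ 2)^-1 ^+ n.+1).
  move=> x'1; rewrite (_ : series _ = fun M => y' ^+ n / pochhammer (1 / 2) n *
      series (fun m => 'C(m + n, m)%:R * x' ^+ m / (2 * m).+1%:R) M).
    by apply: cvgMl_tmp; exact: cvg_series_negative_binomial_Rintegral.
  by apply/funext => M; rewrite /series/= mulr_sumr; apply: eq_bigr => m _; rewrite mulrC.
apply: sum_iterated.
- move=> n; under [X in series X]eq_fun => m.
    rewrite humbert_Psi1_termE !normrM !normfV !normr_nat !normrX.
    rewrite (ger0_norm (ltW (pochhammer_gt0 _ _))); last by lra.
    over.
  by apply: row; rewrite normr_id.
- by apply: cvg_series_half_kummer_Rintegral; rewrite normr_id.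
- by move=> n; under [X in series X]eq_fun do rewrite humbert_Psi1_termE; exact: row.
- exact: cvg_series_half_kummer_Rintegral.
Qed.

End half_kummer.

(** * The Gaussian asymptotics *)
Local Notation integral0_gauss := gauss_integral_proof.integral0_gauss.
Local Notation integral0_gauss_ge0 := gauss_integral_proof.integral0_gauss_ge0.

Section gauss.
Context {R : realType}.
Implicit Types (x s : R).

Lemma integral0_gauss_le x : integral0_gauss x <= Num.sqrt pi / 2 :> R.
Proof.
rewrite -lee_fin -integral0y_gauss fineK; last first.
  by apply: integrable_fin_num => //; apply: integrableS integrableT_gauss.
apply: ge0_subset_integral => //.
- by apply/measurable_EFinP/measurable_funTS; exact: measurable_gauss_fun.
- by move=> t _; rewrite lee_fin gauss_fun_ge0.
- by move=> t /=; rewrite !in_itv/= => /andP[->].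
Qed.

Lemma cvg_integral0_gauss : integral0_gauss x @[x --> +oo] --> (Num.sqrt pi / 2 : R).
Proof.
have : Num.sqrt (integral0_gauss x ^+ 2) @[x --> +oo] --> (Num.sqrt (pi / 4) : R).
  apply: continuous_cvg; first exact: sqrt_continuous.
  exact: gauss_integral_proof.cvg_integral0_gauss_sqr.
under eq_fun do rewrite sqrtr_sqr ger0_norm ?integral0_gauss_ge0//.
rewrite sqrtrM ?pi_ge0// sqrtrV// (_ : 4 = 2 ^+ 2 :> R) ?sqrtr_sqr ?ger0_norm//.
by ring.
Qed.

Lemma integrable_gauss_scale x :
  lebesgue_measure.-integrable (`[0, 1] : set R) (EFin \o (fun v => gauss_fun (x * v))).
Proof.
apply: (@bounded_integrable _ _ _ _ _ _ 1) => //.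
- exact: lebesgue_measure01_lty.
- apply: (@measurableT_comp _ _ _ _ _ _ gauss_fun); first exact: measurable_gauss_fun.
  exact: measurable_funM.
- by move=> t _; rewrite ger0_norm ?gauss_fun_ge0// gauss_fun_le1.
Qed.

Lemma integral0_gauss_scale x : 0 < x ->
  integral0_gauss x = x * \int[lebesgue_measure]_(v in `[0, 1]) gauss_fun (x * v).
Proof.
move=> x0; have dx (v : R) : is_derive v (1 : R) (fun v : R => x * v) x.
  have := @is_deriveZ R R R id x v 1 1 (@is_derive_id R R v 1).
  by rewrite /GRing.scale/= mulr1.
have dE : derive1 (fun v : R => x * v) = cst x.
  by apply/funext => v; rewrite derive1E derive_val.
have cx : continuous (fun v : R => x * v) by move=> v; exact: mulrl_continuous.
rewrite -RintegralZl//; last exact: integrable_gauss_scale.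
have := @integration_by_substitution_increasing R (fun v => x * v) gauss_fun 0 1 ler01.
rewrite mulr0 mulr1 dE => sub.
rewrite /integral0_gauss /Rintegral sub; first last.
- by apply: continuous_subspaceT; exact: continuous_gauss_fun.
- split; last 2 first.
  + by apply: cvg_at_right_filter; exact: cx.
  + by apply: cvg_at_left_filter; exact: cx.
  + by move=> v _; exact: ex_derive.
- exact: is_cvg_cst.
- exact: is_cvg_cst.
- by move=> v _; exact: cvg_cst.
- by move=> u v _ _; rewrite ltr_pM2l.
by congr fine; apply: eq_integral => v _ /=; rewrite mulrC.
Qed.

(** Hence 1F1(1; 1/2; w) grows like [sqrt (pi w) * exp w]: the last factor tends
    to [sqrt pi / 2]. *)
Lemma half_kummer_sqr s : 0 < s ->
  half_kummer (s ^+ 2) = 1 + 2 * s * expR (s ^+ 2) * integral0_gauss s.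
Proof.
move=> s0; rewrite integral0_gauss_scale// /half_kummer; congr (_ + _).
under eq_Rintegral => v _.
  rewrite (_ : expR _ = expR (s ^+ 2) * gauss_fun (s * v)).
  over.
  by rewrite /gauss_fun -expRD exprMn; congr expR; ring.
rewrite RintegralZl//; last exact: integrable_gauss_scale.
by ring.
Qed.

End gauss.

(** * The limit *)

Section limit.
Context {R : realType} (a : R) (a_gt0 : 0 < a).
Implicit Types (z t : R).

Local Notation q z t := ((1 + z * t ^+ 2)^-1).

Let q_le z t : 0 < z -> 0 < q z t <= 1.
Proof.
move=> z0; have h : 1 <= 1 + z * t ^+ 2 by rewrite lerDl mulr_ge0 ?sqr_ge0// ltW.
by rewrite invr_gt0 (lt_le_trans ltr01)//= invf_le1// (lt_le_trans ltr01).
Qed.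

(** With [a = xi / sqrt 2] the second variable of the function is [a ^ 2 / z]. *)
Definition scaled_integrand z t : R :=
  expR (- (a ^+ 2 / z)) * Num.sqrt z * (q z t * half_kummer (a ^+ 2 / z * q z t)).

(** Put [q = 1 / (1 + z t ^ 2)] and [w = a ^ 2 q / z], the argument of
    [half_kummer]. Then [sqrt z * sqrt w = a * sqrt q] absorbs the factor
    [sqrt z], and [w - a ^ 2 / z = - (a t) ^ 2 q] stays bounded, so that the
    exponential growth is cancelled exactly. *)
Lemma scaled_integrandE z t : 0 < z ->
  scaled_integrand z t =
  expR (- (a ^+ 2 / z)) * Num.sqrt z * q z t +
  2 * a * (Num.sqrt (q z t) * q z t) * expR (- ((a * t) ^+ 2 * q z t)) *
    integral0_gauss (Num.sqrt (a ^+ 2 / z * q z t)).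
Proof.
move=> z0; have /andP[q0 _] := q_le t z0.
have w0 : 0 < a ^+ 2 / z * q z t by rewrite mulr_gt0// divr_gt0// exprn_gt0.
rewrite /scaled_integrand.
rewrite -[in half_kummer _](sqr_sqrtr (ltW w0)) half_kummer_sqr ?sqrtr_gt0//.
rewrite (sqr_sqrtr (ltW w0)).
have -> : - ((a * t) ^+ 2 * q z t) = a ^+ 2 / z * q z t - a ^+ 2 / z.
  field.
  by rewrite gt_eqF//= gt_eqF// ltr_wpDr// mulr_ge0 ?sqr_ge0 ?ltW.
rewrite expRD.
have sE : Num.sqrt z * Num.sqrt (a ^+ 2 / z * q z t) = a * Num.sqrt (q z t).
  rewrite -sqrtrM ?(ltW z0)// mulrCA mulrA divfK ?gt_eqF// sqrtrM ?sqr_ge0//.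
  by rewrite sqrtr_sqr gtr0_norm.
transitivity (expR (- (a ^+ 2 / z)) * Num.sqrt z * q z t + 2 * q z t *
  (expR (a ^+ 2 / z * q z t) * expR (- (a ^+ 2 / z))) *
  (Num.sqrt z * Num.sqrt (a ^+ 2 / z * q z t)) *
  integral0_gauss (Num.sqrt (a ^+ 2 / z * q z t))); first by ring.
by rewrite sE; ring.
Qed.

Lemma scaled_integrand_le z t : 0 < z -> z <= 1 ->
  `|scaled_integrand z t| <= 1 + 2 * a * (Num.sqrt pi / 2).
Proof.
move=> z0 z1; have /andP[q0 q1] := q_le t z0.
rewrite scaled_integrandE// (le_trans (ler_normD _ _))// lerD//.
  rewrite ger0_norm ?mulr_ge0 ?expR_ge0 ?sqrtr_ge0 ?(ltW q0)//.
  rewrite mulr_ile1 ?mulr_ge0 ?expR_ge0 ?sqrtr_ge0 ?(ltW q0)//.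
  rewrite mulr_ile1 ?expR_ge0 ?sqrtr_ge0//.
    by rewrite expR_le1 oppr_le0 divr_ge0 ?sqr_ge0 ?ltW.
  by rewrite -[leRHS]sqrtr1 ler_wsqrtr.
rewrite ger0_norm; last by
  rewrite !mulr_ge0 ?expR_ge0 ?sqrtr_ge0 ?integral0_gauss_ge0 ?(ltW q0)
    ?(ltW a_gt0).
rewrite ler_pM ?integral0_gauss_ge0 ?integral0_gauss_le//.
  by rewrite !mulr_ge0 ?expR_ge0 ?sqrtr_ge0 ?(ltW q0) ?(ltW a_gt0).
rewrite -mulrA ler_piMr ?mulr_ge0 ?(ltW a_gt0)//.
rewrite mulr_ile1 ?mulr_ge0 ?expR_ge0 ?sqrtr_ge0 ?(ltW q0)//.
  rewrite mulr_ile1 ?sqrtr_ge0 ?(ltW q0)//.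
  by rewrite -[leRHS]sqrtr1 ler_wsqrtr.
by rewrite expR_le1 oppr_le0 mulr_ge0 ?sqr_ge0 ?ltW.
Qed.

Lemma cvg_scaled_integrand t : `|t| <= 1 ->
  scaled_integrand z t @[z --> 0^'+] -->
  2 * a * (Num.sqrt pi / 2) * gauss_fun (a * t).
Proof.
move=> t1.
have sqrt0 : Num.sqrt z @[z --> 0^'+] --> (0 : R).
  by rewrite -[X in _ --> X]sqrtr0; apply: cvg_at_right_filter; exact: sqrt_continuous.
have q1 : q z t @[z --> 0^'+] --> (1 : R).
  rewrite -[X in _ --> X]invr1; apply: cvgV => //.
  rewrite -[X in _ --> X]addr0 -[X in _ --> _ + X](mul0r (t ^+ 2)).
  apply: cvgD; first exact: cvg_cst.
  by apply: cvgMr_tmp; apply: cvg_at_right_filter; exact: cvg_id.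
have sq1 : Num.sqrt (q z t) @[z --> 0^'+] --> (1 : R).
  rewrite -[X in _ --> X]sqrtr1; apply: continuous_cvg q1; exact: sqrt_continuous.
have sy : Num.sqrt (a ^+ 2 / z * q z t) @[z --> 0^'+] --> +oo.
  apply/cvgryPge => A; near=> z.
  have z0 : 0 < z by [].
  have z1 : z <= 1.
    by near: z; apply: nbhs_right_le.
  (* this bound makes a ^ 2 / (2 z) at least A ^ 2 + 1, while q is at least 1/2 *)
  have zA : z <= a ^+ 2 / 2 / (A ^+ 2 + 1).
    near: z; apply: nbhs_right_le.
    by rewrite !divr_gt0// ?exprn_gt0// ltr_wpDl// sqr_ge0.
  rewrite (le_trans (ler_norm _))// -sqrtr_sqr ler_wsqrtr//.
  have q2 : 2^-1 <= q z t.
    have t2 : t ^+ 2 <= 1 by rewrite -[t ^+ 2]real_normK ?num_real// exprn_ile1.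
    have zt : 0 <= z * t ^+ 2 by rewrite mulr_ge0 ?sqr_ge0 ?ltW.
    have zt1 : z * t ^+ 2 <= 1 by rewrite mulr_ile1 ?sqr_ge0 ?(ltW z0).
    rewrite lef_pV2 ?posrE//; lra.
  apply: (@le_trans _ _ (a ^+ 2 / z / 2)); last first.
    by apply: ler_wpM2l => //; rewrite divr_ge0 ?sqr_ge0 ?ltW.
  rewrite ler_pdivlMr// ler_pdivlMr//.
  move: zA; rewrite ler_pdivlMr ?ltr_wpDl ?sqr_ge0//; nra.
have e0 : expR (- (a ^+ 2 / z)) * Num.sqrt z * q z t @[z --> 0^'+] --> (0 : R).
  apply: (@squeeze_cvgr _ _ _ _ (cst 0) (@Num.sqrt R)) => //; last exact: cvg_cst.
  near=> z; have z0 : 0 < z by [].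
  have /andP[q0 ?] := q_le t z0.
  rewrite !mulr_ge0 ?expR_ge0 ?sqrtr_ge0 ?(ltW q0)//= mulrAC ler_piMl ?sqrtr_ge0//.
  rewrite mulr_ile1 ?expR_ge0 ?(ltW q0)//.
  by rewrite expR_le1 oppr_le0 divr_ge0 ?sqr_ge0 ?ltW.
have main : 2 * a * (Num.sqrt (q z t) * q z t) * expR (- ((a * t) ^+ 2 * q z t)) *
    integral0_gauss (Num.sqrt (a ^+ 2 / z * q z t)) @[z --> 0^'+] -->
    2 * a * (1 * 1) * expR (- ((a * t) ^+ 2 * 1)) * (Num.sqrt pi / 2).
  apply: cvgM; last by apply: cvg_comp sy _; exact: cvg_integral0_gauss.
  apply: cvgM.
    by apply: cvgM; [exact: cvg_cst|exact: cvgM].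
  apply: continuous_cvg; first exact: continuous_expR.
  by apply: cvgN; apply: cvgMl_tmp.
have -> : 2 * a * (Num.sqrt pi / 2) * gauss_fun (a * t) =
    0 + 2 * a * (1 * 1) * expR (- ((a * t) ^+ 2 * 1)) * (Num.sqrt pi / 2).
  by rewrite /gauss_fun !mulr1; ring.
apply: cvg_trans (cvgD e0 main); apply: near_eq_cvg; near=> z.
by rewrite /= scaled_integrandE.
Unshelve. all: by end_near. Qed.

Let measurable_integrand z : 0 < z -> z < 1 ->
  measurable_fun (`[0, 1] : set R) (fun t => q z t * half_kummer (a ^+ 2 / z * q z t)).
Proof.
move=> z0 z1; have mq : measurable_fun (`[0, 1] : set R) (fun t => q z t).
  have := @measurable_negative_power _ (- z) 1; rewrite normrN gtr0_norm// => /(_ z1).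
  rewrite [X in measurable_fun _ X -> _](_ : _ = (fun t => q z t))//.
  by apply/funext => t; rewrite mulNr opprK expr1.
apply: measurable_funM => //.
apply: (@measurableT_comp _ _ _ _ _ _ (@half_kummer R)); first exact: measurable_half_kummer.
exact: measurable_funM.
Qed.

Lemma measurable_scaled_integrand z : 0 < z -> z < 1 ->
  measurable_fun (`[0, 1] : set R) (scaled_integrand z).
Proof.
by move=> z0 z1; apply: measurable_funM => //; exact: measurable_integrand.
Qed.

(** The restriction to [z < 1] is the convergence condition of the double series
    at the first variable [- z]. *)
Lemma scaled_humbert_Psi1_Rintegral z : 0 < z -> z < 1 ->
  expR (- (a ^+ 2 / z)) * Num.sqrt z *
    humbert_Psi1 1 (1 / 2) (3 / 2) (1 / 2) (- z) (a ^+ 2 / z) =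
  \int[lebesgue_measure]_(t in `[0, 1]) scaled_integrand z t.
Proof.
move=> z0 z1; rewrite humbert_Psi1_Rintegral ?normrN ?gtr0_norm//.
under [in LHS]eq_Rintegral do rewrite mulNr opprK.
rewrite -RintegralZl//.
pose c := expR (- (a ^+ 2 / z)) * Num.sqrt z.
have c0 : 0 < c by rewrite mulr_gt0 ?expR_gt0 ?sqrtr_gt0.
apply: (@bounded_integrable _ _ _ _ _ _
  (c^-1 * (1 + 2 * a * (Num.sqrt pi / 2)))) => //.
- exact: lebesgue_measure01_lty.
- exact: measurable_integrand.
- move=> t _; rewrite ler_pdivlMl// -[X in X * _](gtr0_norm c0) -normrM.
  exact: scaled_integrand_le _ (ltW z1).
Qed.

(** Bounded convergence along an arbitrary sequence tending to [0] from the right;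
    the tail starting at [N] stays below [1]. *)
Lemma cvg_scaled_humbert_Psi1 :
  expR (- (a ^+ 2 / z)) * Num.sqrt z *
    humbert_Psi1 1 (1 / 2) (3 / 2) (1 / 2) (- z) (a ^+ 2 / z) @[z --> 0^'+] -->
  Num.sqrt pi * integral0_gauss a.
Proof.
have -> : Num.sqrt pi * integral0_gauss a = \int[lebesgue_measure]_(t in `[0, 1])
    (2 * a * (Num.sqrt pi / 2) * gauss_fun (a * t)).
  rewrite RintegralZl//; first by rewrite integral0_gauss_scale//; field.
  exact: integrable_gauss_scale.
apply/cvg_at_rightP => u [u0 ul].
have [N _ uN] : \forall k \near \oo, u k < 1 by apply: (cvgr_lt 0).
rewrite -(cvg_shiftn N).
apply: cvg_trans; last first.
  apply: (@bounded_cvg_Rintegral _ _ _ lebesgue_measure `[0, 1]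
    (fun k => scaled_integrand (u (k + N)%N)) _ (1 + 2 * a * (Num.sqrt pi / 2))) => //.
  - exact: lebesgue_measure01_lty.
  - by move=> k; apply: measurable_scaled_integrand => //; apply: uN; rewrite /= leq_addl.
  - move=> k t _; apply: scaled_integrand_le => //; apply/ltW/uN.
    by rewrite /= leq_addl.
  - move=> t; rewrite /= in_itv/= => /andP[t0 t1].
    have : `|t| <= 1 by rewrite ger0_norm.
    move=> /cvg_scaled_integrand/cvg_at_rightP; apply; split => //.
    by rewrite (cvg_shiftn N (fun k => u k)).
apply: near_eq_cvg; apply: nearW => k.
by rewrite /= scaled_humbert_Psi1_Rintegral//; apply: uN; rewrite /= leq_addl.
Qed.

End limit.

Theorem mainTheorem1 (R : realType) (xi : R) (xi_gt0 : 0 < xi) :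
  expR (- (xi ^+ 2 / (2 * z))) * z `^ (1 / 2) *
    humbert_Psi1 1 (1 / 2) (3 / 2) (1 / 2) (- z) (xi ^+ 2 / (2 * z))
  @[z --> 0^'+] --> pi / 2 * erf (xi / Num.sqrt 2).
Proof.
set a := xi / Num.sqrt 2.
have a0 : 0 < a by rewrite divr_gt0// sqrtr_gt0.
have spi : 0 < Num.sqrt pi :> R by rewrite sqrtr_gt0 pi_gt0.
have -> : pi / 2 * erf a = Num.sqrt pi * gauss_integral_proof.integral0_gauss a.
  rewrite /erf (ltW a0) -{1}[pi](sqr_sqrtr (pi_ge0 R)).
  rewrite /gauss_integral_proof.integral0_gauss /gauss_fun; field.
  by rewrite gt_eqF.
apply: cvg_trans (cvg_scaled_humbert_Psi1 a0).
apply: near_eq_cvg; near=> z; have z0 : 0 < z by [].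
have -> : xi ^+ 2 / (2 * z) = a ^+ 2 / z.
  by rewrite /a expr_div_n sqr_sqrtr// invfM mulrA.
by rewrite [1 / 2]mul1r powR12_sqrt ?(ltW z0).
Unshelve. all: by end_near. Qed.
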